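(* Let $L$ be an $n$-Lie algebra over a field and let $M$ be an ideal of $L$ such that $M\subseteq Z_2^*(L)$. Then the natural homomorphism $\psi:\mathcal{M}^{(2)}(L)\longrightarrow \mathcal{M}^{(2)}(L/M)$ is one-to-one.
   Context: An $n$-Lie algebra ($n\ge 2$) is a vector space $L$ over a field with a multilinear skew-symmetric operation $[x_1,\ldots,x_n]$ satisfying $[[x_1,\ldots,x_n],y_2,\ldots,y_n]=\sum_{i=1}^n[x_1,\ldots,[x_i,y_2,\ldots,y_n],\ldots,x_n]$. An ideal is a subspace $I$ with $[I,L,\dots,L]\subseteq I$. For subalgebras $L_1,\dots,L_n$, $[L_1,\dots,L_n]$ is the subalgebra generated by all $[x_1,\dots,x_n]$ with $x_i\in L_i$; $L^1=L$, $L^{i+1}=[L^i,L,\dots,L]$. The center is $Z(L)=\{z\in L: [z,L,\dots,L]=0\}$; the upper central series is $Z_0(L)=0$, $Z_1(L)=Z(L)$, $Z_i(L)/Z_{i-1}(L)=Z(L/Z_{i-1}(L))$. $L$ is $c$-capable if there is an $n$-Lie algebra $H$ with $L\cong H/Z_c(H)$. $Z_c^*(L)$ is the smallest ideal $M$ of $L$ such that $L/M$ is $c$-capable. If $L\cong F/R$ with $F$ a free $n$-Lie algebra, then $\mathcal{M}^{(2)}(L)=\dfrac{R\cap F^{3}}{\gamma_{3}(R,F,\ldots,F)}$, where $\gamma_3(R,F,\dots,F)=[[R,F,\dots,F],F,\dots,F]$. If $M\cong S/R$ with $R\subseteq S\unlhd F$, then $L/M\cong F/S$ and the natural homomorphism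 is $\psi(x+\gamma_3(R,F,\dots,F))=x+\gamma_3(S,F,\dots,F)$. *)

(* Defs.v *)
From HB Require Import structures.
From mathcomp Require Import all_boot all_order all_algebra all_fingroup.
From mathcomp Require Import generic_quotient ring_quotient.
From mathcomp Require Import boolp classical_sets.

Set Implicit Arguments.
Unset Strict Implicit.
Unset Printing Implicit Defensive.

Import GRing.Theory.
Local Open Scope ring_scope.
Local Open Scope classical_set_scope.
Local Open Scope quotient_scope.

(* The n-tuple (v, y_2, ..., y_n): the entry of y at position 0 is ignored.   *)
Definition hd (T : Type) (n : nat) (v : T) (y : 'I_n -> T) : 'I_n -> T :=
  fun j => if val j == 0%N then v else y j.

Definition upd (T : Type) (n : nat) (x : 'I_n -> T) (i : 'I_n) (v : T) :
  'I_n -> T := fun j => if j == i then v else x j.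

(* In br_skew the coercion of p to bool is its parity.  In characteristic 2   *)
(* skew symmetry does not force the bracket to vanish on tuples with a        *)
(* repeated entry.                                                            *)
HB.mixin Record isNLie (n : nat) (K : fieldType) L of GRing.Lmodule K L := {
  br : ('I_n -> L) -> L;
  arity_gt1 : (1 < n)%N;
  br_multilinear : forall (x : 'I_n -> L) (i : 'I_n) (a : K) (u v : L),
    br (upd x i (a *: u + v)) = a *: br (upd x i u) + br (upd x i v);
  br_skew : forall (x : 'I_n -> L) (p : 'S_n), br (x \o p) = (-1) ^+ p *: br x;
  br_jacobi : forall x y : 'I_n -> L,
    br (hd (br x) y) = \sum_(i < n) br (upd x i (br (hd (x i) y)))
}.

#[short(type="nLieType")]
HB.structure Definition NLie (n : nat) (K : fieldType) :=
  {L of GRing.Lmodule K L & isNLie n K L}.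

Variant upd_spec T n (x : 'I_n -> T) i v : 'I_n -> T -> Type :=
| UpdIn : upd_spec x i v i v
| UpdOut j of i != j : upd_spec x i v j (x j).

Lemma updP T n (x : 'I_n -> T) i v j : upd_spec x i v j (upd x i v j).
Proof.
rewrite /upd; case: eqVneq => [->|]; first by constructor.
by rewrite eq_sym; constructor.
Qed.

Lemma upd_in T n (x : 'I_n -> T) i v : upd x i v i = v.
Proof. by rewrite /upd eqxx. Qed.

Lemma upd_out T n (x : 'I_n -> T) i v j : i != j -> upd x i v j = x j.
Proof. by rewrite /upd eq_sym => /negPf ->. Qed.

Section Morphisms.
Variables (n : nat) (K : fieldType).
Implicit Types A B : nLieType n K.

Definition nlie_hom A B (f : A -> B) : Prop :=
  (forall (a : K) (u v : A), f (a *: u + v) = a *: f u + f v) /\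
  (forall x : 'I_n -> A, f (br x) = br (f \o x)).

Definition nlie_iso A B (f : A -> B) : Prop := nlie_hom f /\ bijective f.

Definition isomorphic A B : Prop := exists f : A -> B, nlie_iso f.

Definition is_free (F : nLieType n K) : Prop :=
  exists (X : Type) (iota : X -> F), forall (A : nLieType n K) (g : X -> A),
    exists! f : F -> A, nlie_hom f /\ f \o iota = g.

End Morphisms.

Section Subobjects.
Variables (n : nat) (K : fieldType) (L : nLieType n K).

Definition is_subspace (A : set L) : Prop :=
  A 0 /\ forall (a : K) (u v : L), A u -> A v -> A (a *: u + v).

Definition is_subalg (A : set L) : Prop :=
  is_subspace A /\ forall x : 'I_n -> L, (forall i, A (x i)) -> A (br x).

Definition is_ideal (I : set L) : Prop :=
  is_subspace I /\ forall (v : L) (y : 'I_n -> L), I v -> I (br (hd v y)).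

Identity Coercion set_to_pred : set >-> Funclass.

Record subalg := Subalg { subalg_set :> set L; subalgP : is_subalg subalg_set }.
Record ideal := Ideal { ideal_set :> set L; idealP : is_ideal ideal_set }.

(* [A_1, ..., A_n] *)
Definition brS (A : 'I_n -> set L) : set L :=
  smallest is_subalg [set br x | x in [set x | forall i, A i (x i)]].

(* [A, L, ..., L] *)
Definition brSL (A : set L) : set L := brS (hd A (fun=> setT)).

End Subobjects.

Arguments is_subalg {n K L} A.
Arguments Subalg {n K L}.
Arguments Ideal {n K L}.

Section BracketTheory.
Variables (n : nat) (K : fieldType) (L : nLieType n K).
Implicit Types (A : set L) (I J : ideal L).

Lemma arity_gt0 : (0 < n)%N.
Proof. exact: ltnW (@arity_gt1 n K L). Qed.

Let i0 : 'I_n := Ordinal arity_gt0.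

Lemma hd_upd (v : L) (y : 'I_n -> L) : hd v y = upd y i0 v.
Proof.
apply: funext => j; rewrite /hd; case: updP => // j' ne.
by case: eqP => // j'0; case/eqP: ne; apply: val_inj.
Qed.

Lemma subspace0 A : is_subspace A -> A 0. Proof. by case. Qed.

Lemma subspaceN A u : is_subspace A -> A u -> A (- u).
Proof.
by move=> [A0 h] Au; have := h (-1) u 0 Au A0; rewrite scaleN1r addr0.
Qed.

Lemma subspaceD A u v : is_subspace A -> A u -> A v -> A (u + v).
Proof. by move=> [A0 h] Au Av; have := h 1 u v Au Av; rewrite scale1r. Qed.

Lemma subspaceZ A a u : is_subspace A -> A u -> A (a *: u).
Proof. by move=> [A0 h] Au; have := h a u 0 Au A0; rewrite addr0. Qed.

Lemma subspaceB A u v : is_subspace A -> A u -> A v -> A (u - v).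
Proof. by move=> hA Au Av; apply: subspaceD => //; apply: subspaceN. Qed.

Lemma ideal_subspace I : is_subspace I. Proof. by case: (idealP I). Qed.

Lemma ideal_in0 I : I 0.
Proof. exact: subspace0 (ideal_subspace I). Qed.

Lemma ideal_br I (x : 'I_n -> L) (i : 'I_n) : I (x i) -> I (br x).
Proof.
move=> Ix; set s := tperm i i0.
have -> : br x = (-1) ^+ s *: br (x \o s).
  by rewrite br_skew scalerA -exprD addnn -mul2n exprM sqrrN !expr1n scale1r.
apply: subspaceZ; first exact: ideal_subspace.
have -> : x \o s = hd (x i) (x \o s).
  apply: funext => j; rewrite /hd; case: eqP => // j0.
  suff -> : j = i0 by rewrite /= /s tpermR.
  exact: val_inj.
exact: (idealP I).2.
Qed.

Lemma ideal_is_subalg I : is_subalg I.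
Proof.
by split=> [|x hx]; [exact: ideal_subspace | exact: (@ideal_br I x i0)].
Qed.

Lemma brB (x : 'I_n -> L) i (u v : L) :
  br (upd x i u) - br (upd x i v) = br (upd x i (u - v)).
Proof. by rewrite addrC -[u - v]addrC -!scaleN1r br_multilinear. Qed.

Lemma br_hd0 (y : 'I_n -> L) : br (hd 0 y) = 0.
Proof.
by rewrite hd_upd -[X in upd y i0 X](subrr 0) -brB subrr.
Qed.

Lemma ideal_br_sub I (x y : 'I_n -> L) :
  (forall i, I (x i - y i)) -> I (br x - br y).
Proof.
move=> h; pose mix (s : seq 'I_n) : 'I_n -> L :=
  fun i => if i \in s then y i else x i.
have -> : y = mix (enum 'I_n).
  by apply: funext => i; rewrite /mix mem_enum.
elim: (enum _) => [|k s IH].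
  have -> : mix [::] = x by apply: funext => i; rewrite /mix.
  by rewrite subrr; exact: ideal_in0.
rewrite -[_ - _](subrKA (br (mix s))); apply: subspaceD (ideal_subspace I) IH _.
have -> : mix (k :: s) = upd (mix s) k (y k).
  apply: funext => j; case: updP => [|j' ne].
    by rewrite /mix mem_head.
  by rewrite /mix in_cons eq_sym (negPf ne).
have {1}-> : mix s = upd (mix s) k (mix s k).
  by apply: funext => j; case: updP.
rewrite brB; apply: (@ideal_br I _ k); rewrite upd_in /mix.
by case: ifP => _ //; rewrite subrr; exact: ideal_in0.
Qed.

Lemma smallest_subalg A : is_subalg (smallest is_subalg A).
Proof.
split; first split.
- by move=> B [[[]]].
- move=> a u v hu hv B hB; have [[[_ hl] _] _] := hB.
  by apply: hl; [apply: hu | apply: hv].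
- move=> x hx B hB; have [[_ hb] _] := hB.
  by apply: hb => i; apply: hx.
Qed.

Lemma brSL_sub_ideal I : brSL I `<=` I.
Proof.
apply: smallest_sub; first exact: ideal_is_subalg.
by move=> _ [x hx <-]; apply: (@ideal_br I x i0); have := hx i0.
Qed.

Lemma brSL_br A v y : A v -> brSL A (br (hd v y)).
Proof.
move=> Av B [_]; apply; exists (hd v y) => // i.
by rewrite /hd; case: ifP.
Qed.

Lemma brSL_mono A B : A `<=` B -> brSL A `<=` brSL B.
Proof.
move=> AB; apply: smallest_sub; first exact: smallest_subalg.
move=> _ [x hx <-] C [_]; apply; exists x => // i.
by have := hx i; rewrite /hd; case: ifP => // _; apply: AB.
Qed.

Lemma brSL_is_ideal I : is_ideal (brSL I).
Proof.
split; first by case: (smallest_subalg [set br x | x in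
  [set x | forall i, hd (I : set L) (fun=> setT) i (x i)]]).
by move=> v y hv; apply: brSL_br; apply: brSL_sub_ideal.
Qed.

Lemma ideal0_is_ideal : is_ideal [set (0 : L)].
Proof.
split=> [|v y /= ->]; last exact: br_hd0.
by split=> // a u v /= -> ->; rewrite scaler0 addr0.
Qed.

Lemma idealT_is_ideal : is_ideal [set: L].
Proof. by []. Qed.

Lemma idealI_is_ideal I J : is_ideal ((I : set L) `&` J).
Proof.
split=> [|v y [Iv Jv]]; last by split; apply: (idealP _).2.
split=> [|a u v [Iu Ju] [Iv Jv]].
  by split; exact: ideal_in0.
by split; apply: (ideal_subspace _).2.
Qed.

Lemma bigcap_is_ideal (P : set (ideal L)) :
  is_ideal (\bigcap_(I in P) (I : set L)).
Proof.
split; last by move=> v y h I PI; apply: (idealP I).2; apply: h.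
split=> [I _|a u v hu hv I PI]; first exact: ideal_in0.
by apply: (ideal_subspace I).2; [apply: hu | apply: hv].
Qed.

Definition center : set L := [set z | forall y : 'I_n -> L, br (hd z y) = 0].

Lemma center_is_ideal : is_ideal center.
Proof.
split=> [|v y /= hv y']; last by rewrite hv br_hd0.
split=> [y|a u v /= hu hv y]; first exact: br_hd0.
by rewrite hd_upd br_multilinear -!hd_upd hu hv scaler0 addr0.
Qed.

End BracketTheory.

Arguments center {n K} L.

Section IdealConstructions.
Variables (n : nat) (K : fieldType) (L : nLieType n K).

Definition ideal_subalg (I : ideal L) : subalg L := Subalg I (ideal_is_subalg I).
Definition ideal0 : ideal L := Ideal [set 0] (@ideal0_is_ideal n K L).
Definition idealT : ideal L := Ideal setT (@idealT_is_ideal n K L).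
Definition idealI (I J : ideal L) : ideal L :=
  Ideal (_ `&` _) (idealI_is_ideal I J).
(* [I, L, ..., L] *)
Definition ideal_br_full (I : ideal L) : ideal L :=
  Ideal (brSL I) (brSL_is_ideal I).
Definition idealZ : ideal L := Ideal (center L) (@center_is_ideal n K L).

(* L^1 = L and L^(i+1) = [L^i, L, ..., L]; the value at i = 0 is irrelevant.  *)
Definition lower_central (i : nat) : ideal L := iter i.-1 ideal_br_full idealT.

(* gamma_3(R, L, ..., L) = [[R, L, ..., L], L, ..., L] *)
Definition gamma3 (R : ideal L) : ideal L := ideal_br_full (ideal_br_full R).

End IdealConstructions.

Arguments lower_central {n K} L i.
Arguments idealZ {n K} L.
Arguments ideal0 {n K} L.

Section Quotient.
Variables (n : nat) (K : fieldType) (L : nLieType n K) (I : ideal L).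

Definition ideal_pred : {pred L} := fun x => `[< ideal_set I x >].

Fact ideal_pred_zmod_closed : zmod_closed ideal_pred.
Proof.
split; first exact/asboolP/ideal_in0.
move=> x y /asboolP Ix /asboolP Iy.
by apply/asboolP; apply: subspaceB => //; apply: ideal_subspace.
Qed.

HB.instance Definition _ :=
  GRing.isZmodClosed.Build L ideal_pred ideal_pred_zmod_closed.

Definition quot : Type := Quotient.quot ideal_pred.

HB.instance Definition _ := GRing.Zmodule.on quot.
HB.instance Definition _ := Quotient.on quot.

Definition qpi (x : L) : quot := \pi_quot x.

Lemma qpi_repr (x : quot) : qpi (repr x) = x.
Proof. exact: reprK. Qed.

Lemma qpi_eqP (x y : L) : qpi x = qpi y <-> I (x - y).
Proof.
rewrite /qpi; split=> [/eqP|h]; last apply/eqP.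
  by rewrite -(Quotient.idealrBE (ideal_pred : zmodClosed L)) => /asboolP.
by rewrite -(Quotient.idealrBE (ideal_pred : zmodClosed L)); apply/asboolP.
Qed.

Lemma qpiD (x y : L) : qpi (x + y) = qpi x + qpi y.
Proof. by rewrite /qpi; rewrite !piE. Qed.

Definition quot_scale (a : K) (x : quot) : quot := qpi (a *: repr x).

Lemma qpiZ a x : qpi (a *: x) = quot_scale a (qpi x).
Proof.
apply/qpi_eqP; rewrite -scalerBr; apply: subspaceZ (ideal_subspace I) _.
by apply/qpi_eqP; rewrite qpi_repr.
Qed.

Fact quot_scaleA a b x : quot_scale a (quot_scale b x) = quot_scale (a * b) x.
Proof. by rewrite -[x]qpi_repr -!qpiZ scalerA. Qed.
Fact quot_scale1 : left_id 1 quot_scale.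
Proof. by move=> x; rewrite -[x]qpi_repr -!qpiZ scale1r. Qed.
Fact quot_scaleDr : right_distributive quot_scale +%R.
Proof.
by move=> a x y; rewrite -[x]qpi_repr -[y]qpi_repr -qpiD -!qpiZ scalerDr qpiD.
Qed.
Fact quot_scaleDl x : {morph quot_scale^~ x : a b / a + b}.
Proof. by move=> a b; rewrite -[x]qpi_repr -!qpiZ scalerDl qpiD. Qed.

HB.instance Definition _ := GRing.Zmodule_isLmodule.Build K quot
  quot_scaleA quot_scale1 quot_scaleDr quot_scaleDl.

Fact qpi_linear : linear qpi.
Proof. by move=> a x y; rewrite qpiD qpiZ. Qed.

HB.instance Definition _ := GRing.isLinear.Build K L quot _ qpi qpi_linear.

Definition quot_br (x : 'I_n -> quot) : quot := qpi (br (repr \o x)).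

Lemma qpi_br x : qpi (br x) = quot_br (qpi \o x).
Proof.
apply/qpi_eqP/ideal_br_sub => i /=; apply/qpi_eqP.
by rewrite qpi_repr.
Qed.

Let qpi_reprf (x : 'I_n -> quot) : x = qpi \o (repr \o x).
Proof. by apply: funext => i /=; rewrite qpi_repr. Qed.

Let qpi_upd (x : 'I_n -> L) i v :
  upd (qpi \o x) i (qpi v) = qpi \o upd x i v.
Proof.
apply: funext => j /=; case: updP => [|j' ne]; first by rewrite upd_in.
by rewrite upd_out.
Qed.

Let qpi_hd (x : 'I_n -> L) v : hd (qpi v) (qpi \o x) = qpi \o hd v x.
Proof. by apply: funext => j /=; rewrite /hd; case: ifP. Qed.

Fact quot_br_multilinear (x : 'I_n -> quot) i (a : K) (u v : quot) :
  quot_br (upd x i (a *: u + v))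
  = a *: quot_br (upd x i u) + quot_br (upd x i v).
Proof.
rewrite (qpi_reprf x) -[u]qpi_repr -[v]qpi_repr -linearP.
by rewrite !qpi_upd -!qpi_br br_multilinear linearP.
Qed.

Fact quot_br_skew (x : 'I_n -> quot) (s : 'S_n) :
  quot_br (x \o s) = (-1) ^+ s *: quot_br x.
Proof.
rewrite (qpi_reprf x) (_ : _ \o s = qpi \o ((repr \o x) \o s)) //.
by rewrite -!qpi_br br_skew linearZ.
Qed.

Fact quot_br_jacobi (x y : 'I_n -> quot) :
  quot_br (hd (quot_br x) y)
  = \sum_(i < n) quot_br (upd x i (quot_br (hd (x i) y))).
Proof.
rewrite (qpi_reprf x) (qpi_reprf y) -qpi_br qpi_hd -qpi_br br_jacobi linear_sum.
apply: eq_bigr => i _; set z := repr \o x.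
by rewrite [(qpi \o z) i]/= qpi_hd -qpi_br qpi_upd -qpi_br.
Qed.

HB.instance Definition _ := isNLie.Build n K quot
  (@arity_gt1 n K L) quot_br_multilinear quot_br_skew quot_br_jacobi.

Lemma qpi_hom : nlie_hom qpi.
Proof. by split=> [a u v|x]; [rewrite linearP | rewrite qpi_br]. Qed.

End Quotient.

Arguments qpi {n K L} I x.

Section Sub.
Variables (n : nat) (K : fieldType) (L : nLieType n K) (A : subalg L).

Definition sub_pred : {pred L} := fun x => `[< subalg_set A x >].

Fact sub_pred_submod_closed : submod_closed sub_pred.
Proof.
have [hA _] := subalgP A.
split; first exact/asboolP/(subspace0 hA).
by move=> a x y /asboolP Ax /asboolP Ay; apply/asboolP; apply: hA.2.
Qed.

HB.instance Definition _ :=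
  GRing.isSubmodClosed.Build K L sub_pred sub_pred_submod_closed.

Definition sub : Type := {x : L | x \in sub_pred}.

HB.instance Definition _ := SubChoice.on sub.
HB.instance Definition _ := [SubChoice_isSubLmodule of sub by <:].

Lemma sub_valP (x : sub) : A (val x).
Proof. exact/asboolP/(valP x). Qed.

Definition insub_alg (x : L) (Ax : A x) : sub := exist _ x (asboolT Ax).

Definition sub_br (x : 'I_n -> sub) : sub :=
  insub_alg ((subalgP A).2 (val \o x) (fun i => sub_valP (x i))).

Let val_upd (x : 'I_n -> sub) i v :
  val \o upd x i v = upd (val \o x) i (val v).
Proof.
apply: funext => j /=; case: updP => [|j' ne]; first by rewrite upd_in.
by rewrite upd_out.
Qed.

Let val_hd (x : 'I_n -> sub) v : val \o hd v x = hd (val v) (val \o x).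
Proof. by apply: funext => j /=; rewrite /hd; case: ifP. Qed.

Fact sub_br_multilinear (x : 'I_n -> sub) i (a : K) (u v : sub) :
  sub_br (upd x i (a *: u + v))
  = a *: sub_br (upd x i u) + sub_br (upd x i v).
Proof.
apply: val_inj; rewrite linearP /= !val_upd -br_multilinear.
by rewrite -[val (_ + _)]/(a *: val u + val v).
Qed.

Fact sub_br_skew (x : 'I_n -> sub) (s : 'S_n) :
  sub_br (x \o s) = (-1) ^+ s *: sub_br x.
Proof. by apply: val_inj; rewrite linearZ /= -br_skew. Qed.

Fact sub_br_jacobi (x y : 'I_n -> sub) :
  sub_br (hd (sub_br x) y)
  = \sum_(i < n) sub_br (upd x i (sub_br (hd (x i) y))).
Proof.
apply: val_inj; rewrite linear_sum /= val_hd br_jacobi.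
by apply: eq_bigr => i _ /=; rewrite val_upd /= val_hd.
Qed.

HB.instance Definition _ := isNLie.Build n K sub
  (@arity_gt1 n K L) sub_br_multilinear sub_br_skew sub_br_jacobi.

Fact sub_ideal_is_ideal (I : ideal L) : is_ideal [set x : sub | I (val x)].
Proof.
split=> [|v y /= Iv]; last by rewrite val_hd; apply: (idealP I).2.
split=> [|a u v /= Iu Iv]; first exact: ideal_in0.
exact: (ideal_subspace I).2.
Qed.

Definition sub_ideal (I : ideal L) : ideal sub :=
  Ideal [set x : sub | I (val x)] (sub_ideal_is_ideal I).

End Sub.

Section Capability.
Variables (n : nat) (K : fieldType).
Implicit Types H L : nLieType n K.

Fact preim_ideal_is_ideal H (I : ideal H) (J : ideal (quot I)) :
  is_ideal (qpi I @^-1` J).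
Proof.
split=> [|v y /= Jv].
  split=> [|a u v /= Ju Jv].
    by rewrite /= linear0; exact: ideal_in0.
  by rewrite linearP; apply: (ideal_subspace J).2.
rewrite (qpi_hom I).2 (_ : _ \o _ = hd (qpi I v) (qpi I \o y)).
  exact: (idealP J).2.
by apply: funext => j; rewrite /hd /=; case: ifP.
Qed.

Definition preim_ideal H (I : ideal H) (J : ideal (quot I)) : ideal H :=
  Ideal (qpi I @^-1` J) (preim_ideal_is_ideal J).

Fixpoint upper_central H (c : nat) : ideal H :=
  if c is c'.+1 then preim_ideal (idealZ (quot (upper_central H c')))
  else ideal0 H.

Definition capable (c : nat) L : Prop :=
  exists H, isomorphic L (quot (upper_central H c)).

(* The smallest ideal M such that L / M is c-capable, obtained as the         *)
(* intersection of all such ideals; see Zstar_capable and Zstar_min.          *)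
Definition Zstar (c : nat) L : ideal L :=
  Ideal _ (bigcap_is_ideal [set M : ideal L | capable c (quot M)]).

Lemma Zstar_min c L (M : ideal L) : capable c (quot M) -> Zstar c L `<=` M.
Proof. by move=> hM; apply: bigcap_inf. Qed.

End Capability.

Section Multiplier.
Variables (n : nat) (K : fieldType) (F : nLieType n K).
Implicit Types R S : ideal F.

Definition mult2_num R : subalg F := ideal_subalg (idealI R (lower_central F 3)).

Lemma gamma3_sub_num R : gamma3 R `<=` mult2_num R.
Proof.
move=> x hx; split.
  by apply: brSL_sub_ideal; apply: brSL_sub_ideal hx.
by apply: brSL_mono hx; apply: brSL_mono.
Qed.

(* (R `&` F^3) / gamma_3(R, F, ..., F): the 2-nilpotent multiplier computed   *)
(* from the presentation F / R.                                               *)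
Definition mult2 R : nLieType n K := quot (sub_ideal (mult2_num R) (gamma3 R)).

Lemma mult2_num_mono R S : R `<=` S -> mult2_num R `<=` mult2_num S.
Proof. by move=> RS x [Rx ?]; split=> //; apply: RS. Qed.

Definition mult2_incl R S (RS : R `<=` S) (x : sub (mult2_num R)) :
  sub (mult2_num S) := insub_alg (mult2_num_mono RS (sub_valP x)).

(* psiE: the class of x is sent to the class of x, for x in R `&` F^3.        *)
Definition psi R S (RS : R `<=` S) (x : mult2 R) : mult2 S :=
  qpi _ (mult2_incl RS (repr x)).

Lemma psiE R S (RS : R `<=` S) (x : sub (mult2_num R)) :
  psi RS (qpi _ x) = qpi _ (mult2_incl RS x).
Proof.
apply/qpi_eqP; rewrite /=.
have /qpi_eqP /= h := qpi_repr (qpi (sub_ideal (mult2_num R) (gamma3 R)) x).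
exact: (brSL_mono (brSL_mono RS)) h.
Qed.

Lemma psi_hom R S (RS : R `<=` S) : nlie_hom (psi RS).
Proof.
split=> [a u v|x].
  rewrite -[u]qpi_repr -[v]qpi_repr -linearP !psiE -linearP.
  by congr qpi; apply: val_inj.
have -> : x = qpi _ \o (repr \o x) by apply: funext => i /=; rewrite qpi_repr.
rewrite -(qpi_hom _).2 psiE.
have -> : psi RS \o (qpi _ \o (repr \o x)) =
    qpi (sub_ideal (mult2_num S) (gamma3 S)) \o (mult2_incl RS \o (repr \o x)).
  by apply: funext => i /=; rewrite psiE.
by rewrite -(qpi_hom _).2; congr qpi; apply: val_inj.
Qed.

End Multiplier.

Section Existence.
Variables (n : nat) (K : fieldType).
Implicit Types A B C H L : nLieType n K.

Lemma nlie_homP A B (f : A -> B) a u v :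
  nlie_hom f -> f (a *: u + v) = a *: f u + f v.
Proof. by case. Qed.

Lemma nlie_hom0 A B (f : A -> B) : nlie_hom f -> f 0 = 0.
Proof.
move=> hf; have := nlie_homP 1 0 0 hf.
by rewrite !scale1r addr0 => /eqP; rewrite -subr_eq subrr => /eqP.
Qed.

Lemma nlie_homB A B (f : A -> B) u v : nlie_hom f -> f (u - v) = f u - f v.
Proof.
by move=> hf; rewrite addrC -scaleN1r (nlie_homP _ _ _ hf) scaleN1r addrC.
Qed.

Lemma nlie_hom_hd A B (f : A -> B) v y :
  nlie_hom f -> f (br (hd v y)) = br (hd (f v) (f \o y)).
Proof.
move=> hf; rewrite hf.2; congr br; apply: funext => j.
by rewrite /hd /=; case: ifP.
Qed.

Lemma nlie_hom_comp A B C (f : A -> B) (g : B -> C) :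
  nlie_hom f -> nlie_hom g -> nlie_hom (g \o f).
Proof.
move=> hf hg; split=> [a u v|x] /=; first by rewrite hf.1 hg.1.
by rewrite hf.2 hg.2.
Qed.

Lemma qpi_surj L (I : ideal L) (y : quot I) : exists x, qpi I x = y.
Proof. by exists (repr y); rewrite qpi_repr. Qed.

Lemma qpi_eq0 L (I : ideal L) x : qpi I x = 0 <-> I x.
Proof. by rewrite -(linear0 (qpi I)) qpi_eqP subr0. Qed.

Lemma isomorphic_of_surj A B C (f : A -> B) (g : A -> C) :
  nlie_hom f -> nlie_hom g ->
  (forall b, exists x, f x = b) -> (forall c, exists x, g x = c) ->
  (forall x, f x = 0 <-> g x = 0) -> isomorphic B C.
Proof.
move=> hf hg sf sg fg.
have fgE x y : f x = f y <-> g x = g y.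
  split=> /eqP; rewrite -subr_eq0 -nlie_homB // => /eqP /fg /eqP.
    by rewrite nlie_homB // subr_eq0 => /eqP.
  by rewrite nlie_homB // subr_eq0 => /eqP.
pose s b := sval (cid (sf b)); pose t c := sval (cid (sg c)).
have sK b : f (s b) = b := svalP (cid (sf b)).
have tK c : g (t c) = c := svalP (cid (sg c)).
have gsf x : g (s (f x)) = g x by apply/fgE; rewrite sK.
exists (g \o s); split; first split=> [a u v|x] /=.
- by rewrite -{1}[u]sK -{1}[v]sK -hf.1 gsf hg.1.
- have {1}-> : x = f \o (s \o x) by apply: funext => i /=; rewrite sK.
  by rewrite -hf.2 gsf hg.2.
exists (f \o t) => [b|c] /=; last by rewrite -[RHS]tK; apply/fgE; rewrite sK.
by rewrite -[RHS]sK; apply/fgE; rewrite tK.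
Qed.

Lemma upper_centralS H c z :
  upper_central H c.+1 z <-> forall y, upper_central H c (br (hd z y)).
Proof.
split=> [hz y|hz y] /=.
  apply/qpi_eq0; rewrite (nlie_hom_hd _ _ (qpi_hom _)); exact: hz.
have -> : y = qpi (upper_central H c) \o (repr \o y).
  by apply: funext => i /=; rewrite qpi_repr.
by rewrite -(nlie_hom_hd _ _ (qpi_hom _)); apply/qpi_eq0; apply: hz.
Qed.

Lemma upper_central_surj A B (f : A -> B) c z :
  nlie_hom f -> (forall b, exists x, f x = b) ->
  upper_central A c z -> upper_central B c (f z).
Proof.
move=> hf sf; elim: c z => [|c IH] z.
  by move=> /= ->; rewrite nlie_hom0.
move=> /upper_centralS hz; apply/upper_centralS => y.
pose t i := sval (cid (sf (y i))).
have -> : y = f \o t by apply: funext => i /=; rewrite (svalP (cid (sf (y i)))).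
by rewrite -nlie_hom_hd //; apply: IH.
Qed.

Lemma upper_central_joint A (I : Type) (B : I -> nLieType n K)
    (f : forall i, A -> B i) c z :
  (forall i, nlie_hom (f i)) -> (forall x, (forall i, f i x = 0) -> x = 0) ->
  (forall i, upper_central (B i) c (f i z)) -> upper_central A c z.
Proof.
move=> hf inj; elim: c z => [|c IH] z hz; first exact: inj.
apply/upper_centralS => y; apply: IH => i.
by rewrite nlie_hom_hd //; move/upper_centralS: (hz i); apply.
Qed.

End Existence.

Section Product.
Variables (n : nat) (K : fieldType) (I : Type) (V : I -> nLieType n K).
Variable n_gt1 : (1 < n)%N.

Definition nprod of (1 < n)%N := forall i, V i.
Let P := nprod n_gt1.

HB.instance Definition _ := gen_eqMixin P.
HB.instance Definition _ := gen_choiceMixin P.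

Let padd (x y : P) : P := fun i => x i + y i.
Let popp (x : P) : P := fun i => - x i.
Let pzero : P := fun i => 0.
Let pscale (a : K) (x : P) : P := fun i => a *: x i.
Let pext (x y : P) : (forall i, x i = y i) -> x = y.
Proof. exact: functional_extensionality_dep. Qed.

Fact nprod_addA : associative padd.
Proof. by move=> x y z; apply: pext => i; rewrite /padd addrA. Qed.
Fact nprod_addC : commutative padd.
Proof. by move=> x y; apply: pext => i; rewrite /padd addrC. Qed.
Fact nprod_add0 : left_id pzero padd.
Proof. by move=> x; apply: pext => i; rewrite /padd add0r. Qed.
Fact nprod_addN : left_inverse pzero popp padd.
Proof. by move=> x; apply: pext => i; rewrite /padd addNr. Qed.

HB.instance Definition _ := GRing.isZmodule.Build P
  nprod_addA nprod_addC nprod_add0 nprod_addN.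

Fact nprod_scaleA a b (x : P) : pscale a (pscale b x) = pscale (a * b) x.
Proof. by apply: pext => i; rewrite /pscale scalerA. Qed.
Fact nprod_scale1 : left_id 1 pscale.
Proof. by move=> x; apply: pext => i; rewrite /pscale scale1r. Qed.
Fact nprod_scaleDr : right_distributive pscale +%R.
Proof. by move=> a x y; apply: pext => i; rewrite /pscale scalerDr. Qed.
Fact nprod_scaleDl (x : P) : {morph pscale^~ x : a b / a + b}.
Proof. by move=> a b; apply: pext => i; rewrite /pscale scalerDl. Qed.

HB.instance Definition _ := GRing.Zmodule_isLmodule.Build K P
  nprod_scaleA nprod_scale1 nprod_scaleDr nprod_scaleDl.

Let ev i (x : P) : V i := x i.
Let pbr (x : 'I_n -> P) : P := fun i => br (ev i \o x).

Let ev_upd i (x : 'I_n -> P) k (v : P) :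
  ev i \o upd x k v = upd (ev i \o x) k (v i).
Proof. by apply: funext => j /=; rewrite /upd; case: ifP. Qed.

Let ev_hd i v (x : 'I_n -> P) : ev i \o hd v x = hd (v i) (ev i \o x).
Proof. by apply: funext => j /=; rewrite /hd; case: ifP. Qed.

Let ev_sum i (E : 'I_n -> P) : (\sum_(k < n) E k) i = \sum_(k < n) E k i.
Proof. exact: (big_morph (fun x : P => x i)). Qed.

Fact nprod_multilinear (x : 'I_n -> P) k (a : K) (u v : P) :
  pbr (upd x k (a *: u + v)) = a *: pbr (upd x k u) + pbr (upd x k v).
Proof.
apply: pext => i; rewrite [RHS]/(a *: pbr _ i + pbr _ i) /pbr !ev_upd.
exact: br_multilinear.
Qed.

Fact nprod_skew (x : 'I_n -> P) (p : 'S_n) : pbr (x \o p) = (-1) ^+ p *: pbr x.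
Proof.
by apply: pext => i; exact: br_skew (ev i \o x) p.
Qed.

Fact nprod_jacobi (x y : 'I_n -> P) :
  pbr (hd (pbr x) y) = \sum_(k < n) pbr (upd x k (pbr (hd (x k) y))).
Proof.
apply: pext => i; rewrite ev_sum /pbr ev_hd br_jacobi.
by apply: eq_bigr => k _; rewrite ev_upd ev_hd.
Qed.

HB.instance Definition _ := isNLie.Build n K P
  n_gt1 nprod_multilinear nprod_skew nprod_jacobi.

End Product.

Section ZstarTheory.
Variables (n : nat) (K : fieldType) (c : nat) (L : nLieType n K).

Lemma Zstar_capable : capable c (quot (Zstar c L)).
Proof.
pose I := {M : ideal L | capable c (quot M)}.
pose N (i : I) : ideal L := sval i.
pose V (i : I) : nLieType n K := sval (cid (svalP i)).
have e0 i : exists e : quot (N i) -> quot (upper_central (V i) c), nlie_iso e.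
  exact: svalP (cid (svalP i)).
pose e i := sval (cid (e0 i)).
have eiso i : nlie_iso (e i) := svalP (cid (e0 i)).
pose P : nLieType n K := nprod V (@arity_gt1 n K L).
pose R (h : P) (l : L) := forall i, qpi _ (h i) = e i (qpi (N i) l).
have R0 : R 0 0.
  move=> i; rewrite (linear0 (qpi (N i))) (nlie_hom0 (eiso i).1).
  exact: linear0.
have Rlin a h l h' l' : R h l -> R h' l' -> R (a *: h + h') (a *: l + l').
  move=> r r' i; rewrite (linearP (qpi (N i))) (eiso i).1.1 -r -r'.
  exact: linearP.
have Rbr (h : 'I_n -> P) (l : 'I_n -> L) :
    (forall k, R (h k) (l k)) -> R (br h) (br l).
  move=> r i; rewrite (qpi_hom (N i)).2 (eiso i).1.2.
  rewrite [br h i]/(br (fun k => h k i)) (qpi_hom _).2; congr br.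
  by apply: funext => k /=; rewrite r.
have GP : is_subalg [set h : P | exists l, R h l].
  split; first split; first by exists 0.
    by move=> a h h' [l r] [l' r']; exists (a *: l + l'); apply: Rlin.
  move=> h hr; pose l k := sval (cid (hr k)).
  by exists (br l); apply: Rbr => k; exact: svalP (cid (hr k)).
pose G := sub (Subalg _ GP).
have Gr (g : G) : exists l, R (val g) l := sub_valP g.
pose l g := sval (cid (Gr g)).
have lP g : R (val g) (l g) := svalP (cid (Gr g)).
have ZE x : Zstar c L x <-> forall i, N i x.
  split=> [hx i|hx M hM]; first exact: hx (svalP i).
  exact: (hx (exist _ M hM)).
have einj i x y : e i (qpi _ x) = e i (qpi _ y) <-> N i (x - y).
  split=> [|h]; last by congr e; apply/qpi_eqP.
  by move/(bij_inj (eiso i).2)/qpi_eqP.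
have Runiq h x y : R h x -> R h y -> qpi (Zstar c L) x = qpi _ y.
  by move=> r r'; apply/qpi_eqP/ZE => i; apply/einj; rewrite -r -r'.
pose f (g : G) := qpi (Zstar c L) (l g).
have fE g x : R (val g) x -> f g = qpi _ x by move=> r; apply: Runiq r.
have Rex x : exists h : P, R h x.
  pose h (i : I) := repr (e i (qpi (N i) x)).
  by exists h => i; rewrite qpi_repr.
exists G; apply: (@isomorphic_of_surj _ _ G _ _ f (qpi _)) => //.
- split=> [a u v|x].
    rewrite (fE _ (a *: l u + l v)) ?linearP //.
    exact: Rlin (lP u) (lP v).
  rewrite (fE _ (br (l \o x))) ?(qpi_hom _).2 //.
  exact: (Rbr (val \o x) _ (fun k => lP (x k))).
- exact: qpi_hom.
- move=> b; have [h r] := Rex (repr b).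
  have Gh : exists l, R h l by exists (repr b).
  exists (@insub_alg _ _ _ (Subalg _ GP) h Gh).
  by rewrite (fE _ (repr b)) ?qpi_repr.
- by move=> b; exists (repr b); rewrite qpi_repr.
pose p i (g : G) : V i := (val g : P) i.
have hp i : nlie_hom (p i) by split.
have sp i b : exists g, p i g = b.
  have [_ [y0 _ can]] := eiso i.
  have [x xE] := qpi_surj (y0 (qpi _ b)).
  have ex j : exists v : V j, qpi _ v = e j (qpi (N j) x) /\
      forall E : i = j, v = eq_rect i V b j E.
    have [E|ne] := pselect (i = j).
      case: _ / E; exists b; split; first by rewrite xE can.
      by move=> E; rewrite (Prop_irrelevance E erefl).
    by exists (repr (e j (qpi (N j) x))); rewrite qpi_repr.
  pose h : P := fun j => sval (cid (ex j)).
  have hP j := svalP (cid (ex j)).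
  have Gh : exists l, R h l by exists x => j; case: (hP j).
  by exists (@insub_alg _ _ _ (Subalg _ GP) h Gh); exact: (hP i).2 erefl.
have pinj x : (forall i, p i x = 0) -> x = 0.
  by move=> h; apply: val_inj; apply: functional_extensionality_dep.
move=> g; split.
  move/qpi_eq0/ZE => h; apply/qpi_eq0/(upper_central_joint hp pinj) => i.
  apply/qpi_eq0; rewrite /p lP.
  rewrite -(nlie_hom0 (eiso i).1); congr e; exact/qpi_eq0.
move/qpi_eq0 => h; apply/qpi_eq0/ZE => i.
rewrite -[l g]subr0; apply/einj; rewrite -lP linear0 (nlie_hom0 (eiso i).1).
by apply/qpi_eq0; apply: (upper_central_surj (hp i) (sp i)).
Qed.

End ZstarTheory.

(* Main.v *)
Require Import Defs.
From mathcomp Require Import all_boot all_algebra classical_sets.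
Local Open Scope classical_set_scope.

(** Injectivity of [psi RS] follows from the inclusion of [gamma3 S] in
    [gamma3 R].  Put [E = F / gamma3 R].  An ideal [A] of [F] satisfies
    [gamma3 A `<=` T] exactly when its image in [F / T] lies in the second centre
    ([gamma3_subE]).  For [A = R] and [T = gamma3 R], this says that [E] is an
    extension of [F / R], hence of [L], whose kernel lies in [Z_2(E)].  For any
    such extension, [E / Z_2(E)] is a 2-capable quotient of [L], so by
    minimality every preimage in [E] of an element of [Zstar 2 L] belongs to
    [Z_2(E)] ([Zstar_upper_central]).  As [M] is contained in [Zstar 2 L], the
    image of [S] in [E] lies in [Z_2(E)], and [gamma3_subE] read backwards is the
    required inclusion. *)

Lemma brSL_subP {n : nat} {K : fieldType} {L : nLieType n K} (A : set L)
    (I : ideal L) :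
  brSL A `<=` I <-> forall v y, A v -> I (br (hd v y)).
Proof.
split=> [AI v y Av|AI]; first by apply: AI; apply: brSL_br.
apply: smallest_sub; first exact: ideal_is_subalg.
move=> _ [x hx <-]; pose i0 : 'I_n := Ordinal (@arity_gt0 n K L).
have -> : x = hd (x i0) x.
  apply: boolp.funext => j; rewrite /hd; case: eqP => // j0.
  by congr x; apply: val_inj.
by apply: AI; have := hx i0.
Qed.

(** Bracketing once with the whole algebra lowers by one the index in the
    upper central series of [L / T]. *)
Lemma brSL_sub_upper_central {n : nat} {K : fieldType} {L : nLieType n K}
    (T : ideal L) (c : nat) (A : set L) :
  brSL A `<=` qpi T @^-1` upper_central (quot T) c <->
  A `<=` qpi T @^-1` upper_central (quot T) c.+1.
Proof.
rewrite (brSL_subP A (preim_ideal (upper_central (quot T) c))).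
split=> [h v Av|h v y Av].
  apply/upper_centralS => y.
  have -> : y = qpi T \o (generic_quotient.repr \o y).
    by apply: boolp.funext => i /=; rewrite qpi_repr.
  by rewrite -(nlie_hom_hd _ _ (qpi_hom T)); exact: h.
rewrite /= (nlie_hom_hd _ _ (qpi_hom T)).
by have /upper_centralS := h v Av; apply.
Qed.

Lemma gamma3_subE {n : nat} {K : fieldType} {L : nLieType n K} (S T : ideal L) :
  gamma3 S `<=` T <-> S `<=` qpi T @^-1` upper_central (quot T) 2.
Proof.
rewrite -!brSL_sub_upper_central.
by split=> h x /h /qpi_eq0.
Qed.

Lemma image_is_ideal {n : nat} {K : fieldType} {A B : nLieType n K} (f : A -> B)
    (I : ideal A) :
  nlie_hom f -> (forall b, exists x, f x = b) -> is_ideal (f @` I).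
Proof.
move=> hf sf; split; first split.
- by exists 0%R; [exact: ideal_in0 | exact: nlie_hom0].
- move=> a _ _ [u Iu <-] [v Iv <-]; exists (a *: u + v)%R; last exact: hf.1.
  exact: (ideal_subspace I).2.
move=> _ y [v Iv <-]; pose t i := sval (boolp.cid (sf (y i))).
have -> : y = f \o t.
  by apply: boolp.funext => i /=; rewrite (svalP (boolp.cid (sf (y i)))).
by exists (br (hd v t)); [exact: (idealP I).2 | exact: nlie_hom_hd].
Qed.

(** If [pi] and [q] present [L] and [E] as quotients of [F], and the elements
    killed by [pi] become [c]-central in [E], then [E / Z_c(E)] is the quotient
    of [L] by the image under [pi] of the preimage [N] of [Z_c(E)].  That
    quotient is [c]-capable, so its kernel contains [Zstar c L]. *)
Lemma Zstar_upper_central {n : nat} {K : fieldType} {F L E : nLieType n K}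
    (c : nat) (pi : F -> L) (q : F -> E) :
  nlie_hom pi -> (forall l, exists x, pi x = l) ->
  nlie_hom q -> (forall e, exists x, q x = e) ->
  (forall x, pi x = 0%R -> upper_central E c (q x)) ->
  forall x, Zstar c L (pi x) -> upper_central E c (q x).
Proof.
move=> hpi spi hq sq ker_pi.
pose qbar := qpi (upper_central E c) \o q.
have hqbar : nlie_hom qbar by apply: nlie_hom_comp hq (qpi_hom _).
have qbar0 x : qbar x = 0%R <-> upper_central E c (q x) by exact: qpi_eq0.
have N_ideal : is_ideal [set x | qbar x = 0%R].
  split=> [|v y /= v0]; last by rewrite nlie_hom_hd // v0 br_hd0.
  split=> [|a u v /= u0 v0]; first exact: nlie_hom0.
  by rewrite hqbar.1 u0 v0 GRing.scaler0 GRing.addr0.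
pose N := Ideal _ N_ideal.
pose piN := Ideal _ (image_is_ideal pi N hpi spi).
have piN_pi x : piN (pi x) <-> qbar x = 0%R.
  split=> [[z Nz zx]|]; last by exists x.
  have : qbar (x - z)%R = 0%R.
    by apply/qbar0/ker_pi; rewrite nlie_homB // zx GRing.subrr.
  by rewrite nlie_homB // Nz GRing.subr0.
have capN : capable c (quot piN).
  exists E; apply: (@isomorphic_of_surj _ _ F _ _ (qpi piN \o pi) qbar) => //.
  - exact: nlie_hom_comp hpi (qpi_hom _).
  - by move=> b; have [l <-] := qpi_surj b; have [x <-] := spi l; exists x.
  - by move=> b; have [e <-] := qpi_surj b; have [x <-] := sq e; exists x.
  - by move=> x; rewrite -piN_pi; exact: qpi_eq0.
by move=> x /(Zstar_min capN)/piN_pi/qbar0.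
Qed.

Theorem theorem3p2 (n : nat) (K : fieldType) (L : nLieType n K) (M : ideal L)
    (hM : M `<=` Zstar 2 L)
    (F : nLieType n K) (hF : is_free F) (R S : ideal F) (RS : R `<=` S)
    (phi : quot R -> L) (hphi : nlie_iso phi)
    (hS : (M : set L) = phi @` (qpi R @` S)) :
  injective (psi RS).
Proof.
have [phi_hom phi_bij] := hphi.
have gammaSR : gamma3 S `<=` gamma3 R.
  apply/gamma3_subE => s Ss /=.
  apply: (Zstar_upper_central 2 (phi \o qpi R) (qpi (gamma3 R))).
  - exact: nlie_hom_comp (qpi_hom R) phi_hom.
  - move=> l; have [phi' _ phiK] := phi_bij.
    by have [x xl] := qpi_surj (phi' l); exists x; rewrite /= xl phiK.
  - exact: qpi_hom.
  - exact: qpi_surj.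
  - move=> x /=; rewrite -(nlie_hom0 phi_hom) => /(bij_inj phi_bij)/qpi_eq0.
    exact: (gamma3_subE R (gamma3 R)).1.
  - by apply: hM; rewrite hS /=; exists (qpi R s) => //; exists s.
move=> u v; rewrite -[u]qpi_repr -[v]qpi_repr !psiE.
by move=> /qpi_eqP h; apply/qpi_eqP; exact: gammaSR h.
Qed.
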